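(* Let $A,H,K$ be events with $H\neq\emptyset$, $K\neq\emptyset$, and let $x=P(A|H)$ (with $P(K|K)=1$, as coherence requires). Then, with the conjunction understood as a conditional random quantity in the setting of coherence, $$(A|H)\wedge(K|K)=A|H,$$ that is, the two random quantities take the same value in every case; in particular $\mathbb{P}[(A|H)\wedge(K|K)]=P(A|H)$.
   Context: Events are elements of a Boolean algebra, $\overline{E}$ is negation, juxtaposition is conjunction, and an event is identified with its $\{0,1\}$-valued indicator; $\mathbb{P}$ denotes prevision. For a random quantity $X$ with finitely many values, an event $H\neq\emptyset$ and an assessed prevision $\mu=\mathbb{P}(X|H)$, the conditional random quantity is $X|H=XH+\mu\overline{H}$. In particular the indicator of a conditional event is $A|H=AH+x\overline{H}$ with $x=P(A|H)$. Coherence: an assessment $(\mu_1,\ldots,\mu_n)$ on conditional random quantities $X_1|H_1,\ldots,X_n|H_n$ is coherent if for every nonempty $J\subseteq\{1,\ldots,n\}$ and all real $s_i$ $(i\in J)$, the values of $G=\sum_{i\in J}s_iH_i(X_i-\mu_i)$ restricted to $\bigvee_{i\in J}H_i$ satisfy $\min G\le 0\le\max G$. All assessments considered are coherent. Conjunction: given $x=P(A|H)$ and $y=P(B|K)$, $(A|H)\wedge(B|K)=(AHBK+x\,\overline{H}BK+y\,AH\overline{K})\,|\,(H\vee K)$; it takes the value $1$ on $AHBK$, $0$ on $\overline{A}H\vee\overline{B}K$, $x$ on $\overline{H}BK$, $y$ on $AH\overline{K}$, and $z=\mathbb{P}[(A|H)\wedge(B|K)]$ on $\overline{H}\,\overline{K}$,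 where $(x,y,z)$ is coherent on $\{A|H,B|K,(A|H)\wedge(B|K)\}$. Here it is applied with $B=K$. *)

(* Defs.v *)
From HB Require Import structures.
From mathcomp Require Import all_boot all_order all_algebra.
From mathcomp Require Import boolp classical_sets functions cardinality reals.

Set Implicit Arguments.
Unset Strict Implicit.
Unset Printing Implicit Defensive.

Import Order.TTheory GRing.Theory Num.Theory.
Local Open Scope classical_set_scope.
Local Open Scope ring_scope.

(* A case is a Boolean homomorphism from the algebra [E] of events to truth
   values; preservation of \bot, \top and joins follows from the two axioms.
   ({tblmorphism _ -> _} only asks for \bot and \top to be preserved.)
   Restricted to finitely many events, a case selects one of the nonempty
   constituents they generate, and every nonempty constituent is selected by
   some case; so the values of a random quantity built from finitely many
   events are the values that it takes on the cases. *)
Record case d (E : ctbDistrLatticeType d) := Case {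
  holds :> E -> bool;
  holdsI : forall A B : E, holds (A `&` B)%O = holds A && holds B;
  holdsC : forall A : E, holds (~` A)%O = ~~ holds A
}.

(* Random quantities with finitely many values. *)
Notation quantity R E := {fimfun case E >-> R}.

Section Coherence.
Context (R : realType) d (E : ctbDistrLatticeType d).
Implicit Types (A B H K : E) (x y z : R).

Definition indicator A (w : case E) : R := (w A)%:R.

Lemma indicator_finite A : finite_set (range (indicator A)).
Proof.
apply: (@sub_finite_set _ _ (range (fun b : bool => b%:R : R))).
  by move=> _ [w _ <-]; exists (w A).
exact/finite_image/finite_finset.
Qed.

HB.instance Definition _ A :=
  FiniteImage.Build _ _ (indicator A) (indicator_finite A).

Definition event_quantity A : quantity R E := indicator A.

Definition scale x (X : quantity R E) : quantity R E := *%R x \o X.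

(* A conditional random quantity [quant | given] with its assessed prevision. *)
Record cond := Cond {
  quant : quantity R E;
  given : E;
  prevision : R
}.

Definition cond_value (C : cond) (w : case E) : R :=
  quant C w * indicator (given C) w
  + prevision C * indicator (~` given C)%O w.

Section Assessment.
Context n (C : n.-tuple cond).

Definition gain (J : {set 'I_n}) (s : 'I_n -> R) (w : case E) : R :=
  \sum_(i in J) s i * indicator (given (tnth C i)) w
                * (quant (tnth C i) w - prevision (tnth C i)).

Definition gain_values (J : {set 'I_n}) (s : 'I_n -> R) : set R :=
  gain J s @` [set w : case E | w (\join_(i in J) given (tnth C i))%O].

Definition coherent : Prop :=
  forall (J : {set 'I_n}) (s : 'I_n -> R), J != finset.set0 ->
  exists m M : R,
    [/\ gain_values J s m /\ lbound (gain_values J s) m,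
        gain_values J s M /\ ubound (gain_values J s) M,
        m <= 0 & 0 <= M].

End Assessment.

Definition cond_event A H x : cond := Cond (event_quantity A) H x.

(* [conjunction A H x B K y z] is (A|H) /\ (B|K), where x = P(A|H),
   y = P(B|K), and z is the prevision assessed for the conjunction itself. *)
Definition conjunction A H x B K y z : cond :=
  Cond (event_quantity (A `&` H `&` B `&` K)%O
        + scale x (event_quantity (~` H `&` B `&` K)%O)
        + scale y (event_quantity (A `&` H `&` ~` K)%O))
       (H `|` K)%O z.

End Coherence.

(* Main.v *)
Require Import Defs.
From mathcomp Require Import all_boot all_order all_algebra.
From mathcomp Require Import boolp classical_sets functions cardinality reals.
From mathcomp Require Import ring.
Import Order.Theory GRing.Theory Num.Theory.
Local Open Scope ring_scope.

(** Coherence forbids a sure gain: a combination of bets whose gain is the same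
    number c in every case where some bet is on must have c = 0, since c is then
    both the minimum and the maximum of the gain ([coherent_sure_gain]).

    Betting on [K|K] alone has the sure gain 1 - y, whence y = 1.  With y = 1
    the conjoined quantity takes, on H, the value of A whether or not K holds,
    and the value x on the rest of H \/ K ([quant_conjunction_self]).  So buying
    the conjunction and selling [A|H] has the sure gain x - z, whence z = x.
    With these two previsions the random quantities agree in every case: both are
    worth A on H and x off H. *)

Section CaseTheory.
Context {d} {E : ctbDistrLatticeType d} (w : case E).

Lemma holdsU A B : w (A `|` B)%O = w A || w B.
Proof.
by rewrite -[(A `|` B)%O]complK complU holdsC holdsI !holdsC negb_and !negbK.
Qed.

Lemma holds0 : w \bot%O = false.
Proof. by rewrite -(meetxC \bot%O) holdsI holdsC andbN. Qed.

Lemma holds_join (I : finType) (J : {set I}) (F : I -> E) :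
  w (\join_(i in J) F i)%O = [exists i in J, w (F i)].
Proof. by rewrite (big_morph w holdsU holds0) big_orE. Qed.

End CaseTheory.

Section SureGain.
Context {R : realType} {d : Order.disp_t} {E : ctbDistrLatticeType d}.

(** The extrema of the gain are attained, so coherence itself provides the cases
    at which to read off c; without a case the hypothesis on the gain would be
    vacuous. *)
Lemma coherent_sure_gain {n} {C : n.-tuple (cond R E)} (J : {set 'I_n})
    (s : 'I_n -> R) {c : R} :
    coherent C -> J != finset.set0 ->
    (forall (w : case E) i, i \in J -> w (given (tnth C i)) ->
       gain C J s w = c) ->
  c = 0.
Proof.
move=> cohC J0 gainE.
have [m [M [[[v /= vJ <-] _] [[u /= uJ <-] _]]]] := cohC J s J0.
move: vJ uJ; rewrite !holds_join => /exists_inP[i iJ vi] /exists_inP[j jJ uj].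
rewrite (gainE v i) // (gainE u j) // => c_le0 c_ge0.
by apply/eqP; rewrite eq_le c_le0.
Qed.

End SureGain.

Section ConjunctionSelf.
Context {R : realType} {d : Order.disp_t} {E : ctbDistrLatticeType d}.
Implicit Types (A H K : E) (x y z : R).

Lemma quant_conjunction_self A H x K z (w : case E) :
  quant (conjunction A H x K K 1 z) w =
  if w H then (w A)%:R else if w K then x else 0.
Proof.
transitivity ((w (A `&` H `&` K `&` K)%O)%:R + x * (w (~` H `&` K `&` K)%O)%:R
              + 1 * (w (A `&` H `&` ~` K)%O)%:R); first by [].
rewrite !holdsI !holdsC.
by case: (w A); case: (w H); case: (w K);
  rewrite /= ?(mulr0, mulr1, addr0, add0r).
Qed.

Lemma cond_value_conjunction_self A H x K (w : case E) :
  cond_value (conjunction A H x K K 1 x) w = cond_value (cond_event A H x) w.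
Proof.
rewrite /cond_value quant_conjunction_self /= /indicator !holdsC holdsU.
by case: (w A); case: (w H); case: (w K) => /=; ring.
Qed.

End ConjunctionSelf.

Theorem mainTheorem4 (R : realType) (d : Order.disp_t)
    (E : ctbDistrLatticeType d) (A H K : E) (x y z : R)
    (hH : H != \bot%O) (hK : K != \bot%O)
    (hcoh : coherent [tuple cond_event A H x; cond_event K K y;
                            conjunction A H x K K y z]) :
  y = 1 /\
  cond_value (conjunction A H x K K y z) =1 cond_value (cond_event A H x) /\
  prevision (conjunction A H x K K y z) = prevision (cond_event A H x).
Proof.
have y1 : y = 1.
  apply/esym/eqP; rewrite -subr_eq0; apply/eqP.
  apply: (coherent_sure_gain [set Ordinal (isT : (1 < 3)%N)]%SET (fun=> 1) hcoh).
    by apply/set0Pn; exists (Ordinal (isT : (1 < 3)%N)); rewrite inE.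
  move=> w i /set1P -> /=; rewrite /gain big_set1 /tnth /= => wK.
  by rewrite /indicator wK !mul1r.
subst y.
have zx : z = x.
  apply/esym/eqP; rewrite -subr_eq0; apply/eqP.
  (* Sell the conditional event at index 0, buy the conjunction at index 2. *)
  apply: (coherent_sure_gain [set~ Ordinal (isT : (1 < 3)%N)]%SET
            (fun i => if i == ord0 then -1 else 1) hcoh).
    by apply/set0Pn; exists ord0; rewrite !inE.
  move=> w i iJ wi.
  have wHK : w H || w K.
    move: iJ wi; rewrite !inE /tnth.
    by case: i => [[|[|[]]] // ?] _ /=; rewrite ?holdsU // => ->.
  rewrite /gain big_mkcond !big_ord_recl big_ord0 !inE /tnth [lift _ _ == _]/=.
  rewrite [nth _ _ _]/= quant_conjunction_self /= /indicator holdsU wHK.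
  by move: wHK; case: (w A); case: (w H); case: (w K) => //= _; ring.
subst z; split=> //; split=> // w.
exact: cond_value_conjunction_self.
Qed.
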